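(* Let $u\subseteq\{1,\dots,d\}$ with $u\neq\varnothing$, $u\neq\{1,\dots,d\}$, let $N,N_u\ge 1$ be integers, and let $\widehat{\text{T-VE}}_{u,\text{PF}}$ be the Pick-Freeze estimator without importance sampling defined in the context. Writing $\text{T-VE}_u=\mathbb{V}_{f_{\mathbf{X}}}\left[\mathbb{E}_{f_{\mathbf{X}}}\left(\psi_t(\mathbf{X})\,|\,\mathbf{X}_u\right)\right]$, one has $$\mathbb{V}_{f_{\mathbf{X}}}\left(\widehat{\text{T-VE}}_{u,\text{PF}}\right)\ge\frac1{N_u}\left(\text{T-VE}_u+p_t^2\right)\left(1-\left(\text{T-VE}_u+p_t^2\right)\right).$$
   Context: $\mathbb{X}=\mathbb{X}_1\times\dots\times\mathbb{X}_d\subseteq\mathbb{R}^d$; $\mathbf{X}=(X_1,\dots,X_d)$ is a random vector in $\mathbb{X}$ with joint density $f_{\mathbf{X}}$ (components possibly dependent); $\phi:\mathbb{X}\to\mathbb{R}$ is a measurable function, $t\in\mathbb{R}$, $\psi_t(\mathbf{x})=\mathbf{1}(\phi(\mathbf{x})>t)$ and $p_t=\mathbb{P}(\phi(\mathbf{X})>t)$. For $u\subseteq\{1,\dots,d\}$, $-u=\{1,\dots,d\}\setminus u$, $\mathbf{X}_u=(X_i)_{i\in u}$, and $(\mathbf{x}_u,\mathbf{x}_{-u})$ denotes the vector of $\mathbb{X}$ with these sub-vectors. $\mathbb{E}_{f_{\mathbf{X}}},\mathbb{V}_{f_{\mathbf{X}}}$ denote expectation and variance when $\mathbf{X}$ (or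 the samples) are drawn from $f_{\mathbf{X}}$. Samples: $(\mathbf{X}_u^{(n)})_{1\le n\le N_u}$ is i.i.d. with the distribution of $\mathbf{X}_u$; for each $n$, conditionally on $\mathbf{X}_u^{(n)}$, $\mathbf{X}_{-u}^{(n,1)},\mathbf{X}_{-u}^{(n,2)}$ are independent with the conditional distribution of $\mathbf{X}_{-u}$ given $\mathbf{X}_u=\mathbf{X}_u^{(n)}$ (independently across $n$). Moreover $\widehat{p}_{t,N}=\frac1N\sum_{n=1}^N\psi_t(\mathbf{X}^{(n)})$ with $(\mathbf{X}^{(n)})_{1\le n\le N}$ i.i.d. with density $f_{\mathbf{X}}$, independent of the preceding samples. Estimator: $$\widehat{\text{T-VE}}_{u,\text{PF}}=\frac1{N_u}\sum_{n=1}^{N_u}\psi_t\left(\mathbf{X}_u^{(n)},\mathbf{X}_{-u}^{(n,1)}\right)\psi_t\left(\mathbf{X}_u^{(n)},\mathbf{X}_{-u}^{(n,2)}\right)-\widehat{p}_{t,N}^{\,2}.$$ *)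

(* Defs.v *)
(* R^d is [d.-tuple R], with the product of the Borel
   sigma-algebras. *)
From HB Require Import structures.
From mathcomp Require Import all_boot all_order all_algebra.
From mathcomp Require Import all_classical all_reals all_analysis.

Set Implicit Arguments.
Unset Strict Implicit.
Unset Printing Implicit Defensive.

Import Order.TTheory GRing.Theory Num.Theory.
Import numFieldNormedType.Exports.

Local Open Scope classical_set_scope.
Local Open Scope ring_scope.

Section lebesgue_tuple.
Context {R : realType}.

Definition cons_pair n (p : R * n.-tuple R) : n.+1.-tuple R :=
  [tuple of p.1 :: p.2].

Lemma measurable_cons_pair n : measurable_fun setT (@cons_pair n).
Proof. exact: measurable_cons. Qed.

(* d-dimensional Lebesgue measure: iterated product of [lebesgue_measure]. *)
Fixpoint lebesgue_tuple n : set (n.-tuple R) -> \bar R :=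
  if n is n'.+1 then
    pushforward (lebesgue_measure \x @lebesgue_tuple n')%E (@cons_pair n')
  else \d_([tuple] : 0.-tuple R).

Lemma lebesgue_tuple_sigma_finite_measure n :
  exists m : {sigma_finite_measure set (n.-tuple R) -> \bar R},
    (m : set (n.-tuple R) -> \bar R) = @lebesgue_tuple n.
Proof.
elim: n => [|n [m IH]] /=.
  by exists (\d_([tuple] : 0.-tuple R)).
rewrite -IH.
pose mp := @measurable_cons_pair n.
pose f := @cons_pair n.
pose mu := pushforward (lebesgue_measure \x m)%E f.
pose un := fun t : n.+1.-tuple R => (thead t, [tuple of behead t]).
have unf : un \o f = id by apply/funext => -[x t]; congr (_, _); exact: val_inj.
have mun : measurable_fun setT un.
  apply/measurable_fun_pairP; split; first exact: measurable_tnth.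
  exact: measurable_behead.
have sf : sigma_finite setT mu.
  have /sigma_finiteP[F [FT ndF Foo]] := sigma_finiteT (@lebesgue_measure R).
  have /sigma_finiteP[G [GT ndG Goo]] := sigma_finiteT m.
  exists (fun i => un @^-1` (F i `*` G i)).
    rewrite -preimage_bigcup (_ : \bigcup_i _ = setT) ?preimage_setT//.
    apply/seteqP; split => // -[x y] _.
    have [i _ Fx] : (\bigcup_i F i) x by rewrite -FT.
    have [j _ Gy] : (\bigcup_j G j) y by rewrite -GT.
    exists (maxn i j) => //; split.
    - by move: x Fx; exact/subsetPset/ndF/leq_maxl.
    - by move: y Gy; exact/subsetPset/ndG/leq_maxr.
  move=> i; have [mF Fi] := Foo i; have [mG Gi] := Goo i.
  have mFG : measurable (F i `*` G i) by exact: measurableX.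
  split; first by rewrite -[_ @^-1` _]setTI; exact: mun.
  rewrite /mu /pushforward -comp_preimage unf preimage_id.
  by rewrite product_measure1E// lte_mul_pinfty// ge0_fin_numE.
pose mm : {sigma_finite_measure set (n.+1.-tuple R) -> \bar R} :=
  HB.pack mu (Measure_isSigmaFinite.Build _ _ _ mu sf).
by exists (mm mp mp mp).
Qed.

Let lebesgue_tuple0 n : @lebesgue_tuple n set0 = 0%E.
Proof. by have [m <-] := lebesgue_tuple_sigma_finite_measure n; exact: measure0. Qed.

Let lebesgue_tuple_ge0 n A : (0 <= @lebesgue_tuple n A)%E.
Proof. by have [m <-] := lebesgue_tuple_sigma_finite_measure n; exact: measure_ge0. Qed.

Let lebesgue_tuple_sigma_additive n : semi_sigma_additive (@lebesgue_tuple n).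
Proof.
have [m <-] := lebesgue_tuple_sigma_finite_measure n.
exact: measure_semi_sigma_additive.
Qed.

HB.instance Definition _ n := isMeasure.Build _ _ _ (@lebesgue_tuple n)
  (lebesgue_tuple0 n) (@lebesgue_tuple_ge0 n) (@lebesgue_tuple_sigma_additive n).

Let lebesgue_tuple_sigma_finite n : sigma_finite setT (@lebesgue_tuple n).
Proof.
by have [m <-] := lebesgue_tuple_sigma_finite_measure n; exact: sigma_finiteT.
Qed.

HB.instance Definition _ n :=
  Measure_isSigmaFinite.Build _ _ _ (@lebesgue_tuple n) (lebesgue_tuple_sigma_finite n).

End lebesgue_tuple.

Section lebesgue_tuple_box.
Context {R : realType}.

Lemma lebesgue_tuple_box n (A : 'I_n -> set R) :
  (forall i, measurable (A i)) ->
  lebesgue_tuple [set x | forall i, A i (tnth x i)] =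
  (\prod_(i < n) lebesgue_measure (A i))%E.
Proof.
elim: n A => [|n IH] A mA.
  rewrite big_ord0 /= diracE mem_set//= => -[].
  by [].
rewrite big_ord_recl /= /pushforward.
rewrite (_ : _ @^-1` _ = A ord0 `*`
    [set y | forall i, A (lift ord0 i) (tnth y i)]); last first.
  apply/seteqP; split=> -[x y] /= h.
    split; first exact: (h ord0).
    by move=> i; have := h (lift ord0 i); rewrite tnthS.
  by move=> i; have [j ->|->] := unliftP ord0 i; [rewrite tnthS; exact: h.2|exact: h.1].
have mB : measurable [set y : n.-tuple R | forall i, A (lift ord0 i) (tnth y i)].
  rewrite (_ : [set _ | _] = \big[setI/setT]_(i < n) ((@tnth _ _ ^~ i) @^-1` A (lift ord0 i))).
    apply: bigsetI_measurable => i _; rewrite -[_ @^-1` _]setTI.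
    exact: measurable_tnth.
  rewrite -bigcap_seq; apply/seteqP; split=> y /= h i; first by move=> _; exact: h.
  by apply: h; rewrite /= mem_index_enum.
rewrite product_measure1E//; last exact: mA.
by congr mule; exact: IH.
Qed.

End lebesgue_tuple_box.

Section subvectors.
Context {R : realType} {d : nat}.
Implicit Types (u : {set 'I_d}) (x : d.-tuple R).

(* The coordinates of [x] indexed by [u], in increasing order of the indices. *)
Definition subvec u x : #|u|.-tuple R := [tuple tnth x (enum_val k) | k < #|u|].

(* The vector with sub-vectors [y] (indices in [u]) and [z] (the others). *)
Definition mergevec u (y : #|u|.-tuple R) (z : #|~: u|.-tuple R) : d.-tuple R :=
  [tuple if i \in u then y`_(index i (enum u)) else z`_(index i (enum (~: u)))
   | i < d].

Lemma mergevecK u x : mergevec (subvec u x) (subvec (~: u) x) = x.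
Proof.
apply: eq_from_tnth => i; rewrite tnth_mktuple.
have nth_subvec (v : {set 'I_d}) : i \in v ->
    (subvec v x)`_(index i (enum v)) = tnth x i.
  move=> iv; have lt_i : (index i (enum v) < #|v|)%N.
    by rewrite cardE index_mem mem_enum.
  rewrite -[index _ _]/(nat_of_ord (Ordinal lt_i)) -tnth_nth tnth_mktuple.
  by rewrite (enum_val_nth i)/= nth_index// mem_enum.
by case: ifPn => iu; apply: nth_subvec; rewrite ?inE.
Qed.

Definition box (S : 'I_d -> set R) : set (d.-tuple R) :=
  [set x | forall i, S i (tnth x i)].

Definition psi (phi : d.-tuple R -> R) (t : R) : d.-tuple R -> R :=
  \1_[set x | t < phi x].

End subvectors.

Section random_elements.
Context {disp : measure_display} {T : measurableType disp} {R : realType}.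
Variable P : probability T R.

Definition has_density {d} (X : T -> d.-tuple R) (f : d.-tuple R -> R) :=
  [/\ measurable_fun setT f, forall x, 0 <= f x &
      forall A, measurable A ->
        P (X @^-1` A) = (\int[lebesgue_tuple (n := d)]_(x in A) (f x)%:E)%E].

Definition same_law {dE} {E : measurableType dE} (Y Z : T -> E) :=
  forall A, measurable A -> P (Y @^-1` A) = P (Z @^-1` A).

(* The product rule over the whole family yields the one over every
   subfamily, by taking [A i = setT] outside of it. *)
Definition mutually_independent {I : finType} {dE} {E : measurableType dE}
    (Y : I -> T -> E) :=
  forall A : I -> set E, (forall i, measurable (A i)) ->
    P (\bigcap_i (Y i @^-1` A i)) = (\prod_i P (Y i @^-1` A i))%E.

Definition sigma_of_family {I : Type} {dE} {E : measurableType dE}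
    (Y : I -> T -> E) : set (set T) :=
  <<s \bigcup_i preimage_set_system setT (Y i) measurable >>.

Definition independent_families {I J : Type} {dE dF}
    {E : measurableType dE} {F : measurableType dF}
    (Y : I -> T -> E) (Z : J -> T -> F) :=
  forall A B, sigma_of_family Y A -> sigma_of_family Z B ->
    P (A `&` B) = (P A * P B)%E.

(* [C] is a version of E(Z | Y). *)
Definition is_cond_expectation {dE} {E : measurableType dE}
    (Z : T -> R) (Y : T -> E) (C : T -> R) :=
  [/\ forall B, measurable B ->
        g_sigma_algebra_preimage Y (C @^-1` B),
      P.-integrable setT (EFin \o C) &
      forall A, g_sigma_algebra_preimage Y A ->
        (\int[P]_(w in A) (C w)%:E = \int[P]_(w in A) (Z w)%:E)%E].

(* [K] is a (regular) conditional distribution of [Z] given [Y]. *)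
Definition is_cond_distribution {dE dF}
    {E : measurableType dE} {F : measurableType dF}
    (Z : T -> F) (Y : T -> E) (K : R.-pker E ~> F) :=
  forall A B, measurable A -> measurable B ->
    P (Y @^-1` A `&` Z @^-1` B) = (\int[P]_(w in Y @^-1` A) K (Y w) B)%E.

(* Conditionally on [Y], [Z1] and [Z2] are independent with distribution
   [K Y]. *)
Definition cond_iid {dE dF} {E : measurableType dE} {F : measurableType dF}
    (Z1 Z2 : T -> F) (Y : T -> E) (K : R.-pker E ~> F) :=
  forall A B1 B2, measurable A -> measurable B1 -> measurable B2 ->
    P (Y @^-1` A `&` Z1 @^-1` B1 `&` Z2 @^-1` B2) =
    (\int[P]_(w in Y @^-1` A) (K (Y w) B1 * K (Y w) B2))%E.

End random_elements.

Section estimators.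
Context {T : Type} {R : realType} {d : nat}.
Variables (phi : d.-tuple R -> R) (t : R).

Definition p_hat N (X : 'I_N -> T -> d.-tuple R) (w : T) : R :=
  N%:R^-1 * \sum_(n < N) psi phi t (X n w).

Definition TVE_PF (u : {set 'I_d}) Nu N (Xu : 'I_Nu -> T -> #|u|.-tuple R)
    (Xc1 Xc2 : 'I_Nu -> T -> #|~: u|.-tuple R) (X : 'I_N -> T -> d.-tuple R)
    (w : T) : R :=
  Nu%:R^-1 * \sum_(n < Nu) (psi phi t (mergevec (Xu n w) (Xc1 n w)) *
                            psi phi t (mergevec (Xu n w) (Xc2 n w)))
  - p_hat X w ^+ 2.

End estimators.

(* Main.v *)
Require Import Defs.
From mathcomp Require Import all_boot all_order all_algebra.
From mathcomp Require Import all_classical all_reals all_analysis.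
From mathcomp Require Import measurable_realfun.
Import Order.TTheory GRing.Theory Num.Theory.
Import numFieldNormedType.Exports.
Local Open Scope classical_set_scope.
Local Open Scope ring_scope.

(* With S the event that the merged vector (y, z) exceeds the threshold and
   g y := K y S_y, conditional independence of the two copies makes each
   product psi * psi the indicator of an event of probability E(g(X_u)^2),
   while E(psi(X) | X_u) = g(X_u) a.e., so that this probability is
   T-VE_u + p_t^2.  The Pick-Freeze average and p_hat^2 are independent, hence
   dropping the variance of the latter leaves the variance of an average of
   Nu pairwise independent indicators. *)

(** * Measurability of boxes, sub-vectors and merged vectors *)

Lemma measurable_box (R : realType) (d : nat) (XX : 'I_d -> set R) :
  (forall i, measurable (XX i)) -> measurable (box XX).
Proof.
move=> mXX.
rewrite (_ : box XX = \big[setI/setT]_(i < d) ((@tnth _ _ ^~ i) @^-1` XX i)).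
  apply: bigsetI_measurable => i _; rewrite -[_ @^-1` _]setTI.
  exact: measurable_tnth.
rewrite -bigcap_seq; apply/seteqP; split=> y /= h i; first by move=> _; exact: h.
by apply: h; rewrite /= mem_index_enum.
Qed.

Lemma measurable_subvec (R : realType) (d : nat) (u : {set 'I_d}) :
  measurable_fun setT (@subvec R d u).
Proof.
apply/measurable_fun_tnthP => k.
rewrite (_ : _ \o _ = (@tnth d R ^~ (enum_val k))); first exact: measurable_tnth.
by apply/funext => x /=; rewrite tnth_mktuple.
Qed.

Lemma measurable_nth_tuple (R : realType) (n k : nat) :
  measurable_fun setT (fun x : n.-tuple R => x`_k).
Proof.
have [kn|nk] := ltnP k n.
  rewrite (_ : (fun _ => _) = (@tnth n R ^~ (Ordinal kn))).
    exact: measurable_tnth.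
  by apply/funext => x; rewrite (tnth_nth 0).
(* Past the end of the tuple [nth] returns its default value 0, whatever [x] is. *)
rewrite (_ : (fun _ => _) = cst 0); first exact: measurable_cst.
by apply/funext => x; rewrite nth_default ?size_tuple.
Qed.

Lemma measurable_mergevec (R : realType) (d : nat) (u : {set 'I_d}) :
  measurable_fun setT
    (fun p : #|u|.-tuple R * #|~: u|.-tuple R => mergevec p.1 p.2).
Proof.
apply/measurable_fun_tnthP => i; have [iu|iu] := boolP (i \in u).
  rewrite (_ : _ \o _ = (fun x : #|u|.-tuple R => x`_(index i (enum u))) \o fst).
    by apply: measurableT_comp => //; exact: measurable_nth_tuple.
  by apply/funext => x /=; rewrite tnth_mktuple iu.
rewrite (_ : _ \o _ =
  (fun x : #|~: u|.-tuple R => x`_(index i (enum (~: u)))) \o snd).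
  by apply: measurableT_comp => //; exact: measurable_nth_tuple.
by apply/funext => x /=; rewrite tnth_mktuple (negbTE iu).
Qed.

(** * Disintegration of joint laws along a probability kernel *)

Section disintegration.
Context {dT dE dF : measure_display} {T : measurableType dT}
  {E : measurableType dE} {F : measurableType dF} {R : realType}.
Variables (P : probability T R) (Y : T -> E) (K : R.-pker E ~> F).
Hypothesis mY : measurable_fun setT Y.
Local Open Scope ereal_scope.

Lemma measurable_kernel_xsection (S : set (E * F)) : measurable S ->
  measurable_fun setT (fun w => K (Y w) (xsection S (Y w))).
Proof.
move=> mS.
apply: (measurableT_comp (f := fun y => K y (xsection S y))) => //.
by apply: measurable_fun_xsection_finite_kernel; rewrite inE.
Qed.

(** In [S] both sides are finite measures that agree on rectangles, a pi-system generating the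
    product sigma-algebra, so Dynkin induction applies. The event [D] and the weight [h] let one
    statement serve twice: [D = setT] and [h = 1] treat a single copy; for two conditionally
    independent copies, [D] is an event about one of them and [h] its conditional probability given
    [Y]. *)
Lemma disintegration (Z : T -> F) (D : set T) (h : T -> R) :
  measurable_fun setT Z -> measurable D ->
  measurable_fun setT h -> (forall w, 0 <= h w)%R ->
  (forall A B, measurable A -> measurable B ->
    P (Y @^-1` A `&` Z @^-1` B `&` D) =
    \int[P]_(w in Y @^-1` A) ((h w)%:E * K (Y w) B)) ->
  forall S, measurable S ->
    P ((fun w => (Y w, Z w)) @^-1` S `&` D) =
    \int[P]_w ((h w)%:E * K (Y w) (xsection S (Y w))).
Proof.
move=> mZ mD mh h0 PYZ S mS.
have mYZ : measurable_fun setT (fun w => (Y w, Z w)).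
  exact: measurable_fun_pair.
have mpre (V : set (E * F)) : measurable V ->
    measurable ((fun w => (Y w, Z w)) @^-1` V `&` D).
  by move=> mV; apply: measurableI => //; rewrite -[_ @^-1` _]setTI; exact: mYZ.
have mhK (V : set (E * F)) : measurable V ->
    measurable_fun setT (fun w => (h w)%:E * K (Y w) (xsection V (Y w))).
  move=> mV; apply: emeasurable_funM; first exact/measurable_EFinP.
  exact: measurable_kernel_xsection.
have hK0 (V : set (E * F)) w : 0 <= (h w)%:E * K (Y w) (xsection V (Y w)).
  by rewrite mule_ge0// lee_fin.
pose C := [set A `*` B | A in @measurable _ E & B in @measurable _ F].
move: (mS); rewrite measurable_prod_measurableType; move: S {mS}.
have rect (A : set E) (B : set F) : measurable A -> measurable B ->
    P ((fun w => (Y w, Z w)) @^-1` (A `*` B) `&` D) =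
    \int[P]_w ((h w)%:E * K (Y w) (xsection (A `*` B) (Y w))).
  move=> mA mB.
  rewrite [X in P (X `&` D)](_ : _ = Y @^-1` A `&` Z @^-1` B)// PYZ//.
  rewrite integral_mkcond; apply: eq_integral => w _; rewrite patchE.
  have [wA|wA] := boolP (w \in _).
    by rewrite in_xsectionX//.
  by rewrite notin_xsectionX ?measure0 ?mule0.
apply: (dynkin_induction (G := C)).
- by rewrite measurable_prod_measurableType.
- move=> _ _ [A1 mA1 [A2 mA2 <-]] [B1 mB1 [B2 mB2 <-]].
  exists (A1 `&` B1); first exact: measurableI.
  exists (A2 `&` B2); first exact: measurableI.
  by rewrite setXI.
- by rewrite -setXTT; exact: rect.
- by move=> _ [A mA [B mB <-]]; exact: rect.
- move=> S mS PS.
  have PT := rect setT setT measurableT measurableT.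
  have fS : P ((fun w => (Y w, Z w)) @^-1` S `&` D) \is a fin_num.
    by rewrite fin_num_measure//; exact: mpre.
  (* Complements: adding the common value at [S], which is finite and hence can be cancelled,
     reduces the claim to the rectangle [setT] times [setT]. *)
  rewrite -[LHS](addeK _ fS) -[RHS](addeK _ fS); congr (_ - _).
  rewrite addeC [RHS]addeC -measureU//; first last.
  + by rewrite setIACA -preimage_setI setICr preimage_set0 set0I.
  + exact/mpre/measurableC.
  + exact: mpre.
  rewrite -setIUl -preimage_setU setUCr -setXTT [LHS]PT.
  rewrite PS -ge0_integralD//; [|exact: mhK|exact/mhK/measurableC].
  apply: eq_integral => w _.
  rewrite -ge0_muleDr// -measureU//; first last.
  + by rewrite -xsectionI setICr xsection0.
  + exact/measurable_xsection/measurableC.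
  + exact/measurable_xsection.
  congr (_ * K _ _); apply/seteqP; split=> z /=.
    by have [|] := pselect (S (Y w, z)); [left|right]; apply/xsectionP.
  by move=> _; apply/xsectionP.
- move=> G mG tG PG.
  rewrite preimage_bigcup setI_bigcupl measure_semi_bigcup//; first last.
  + by apply: bigcup_measurable => k _; exact: mpre.
  + apply/trivIsetP => i j _ _ ij; rewrite setIACA -preimage_setI.
    by move/trivIsetP : tG => ->//; rewrite preimage_set0 set0I.
  + by move=> k; exact: mpre.
  rewrite (eq_eseriesr (fun k _ => PG k)).
  rewrite -integral_nneseries//; last by move=> n; exact: mhK.
  apply: eq_integral => w _; rewrite nneseriesZl//; congr (_ * _).
  rewrite xsection_bigcup measure_semi_bigcup//.
  + by move=> k; exact: measurable_xsection.
  + exact: trivIset_xsection.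
  + by apply: bigcup_measurable => k _; exact: measurable_xsection.
Qed.

Lemma cond_distribution_xsection (Z : T -> F) (B : set E) (S : set (E * F)) :
  measurable_fun setT Z -> is_cond_distribution P Z Y K ->
  measurable B -> measurable S ->
  P (Y @^-1` B `&` (fun w => (Y w, Z w)) @^-1` S) =
  \int[P]_(w in Y @^-1` B) K (Y w) (xsection S (Y w)).
Proof.
move=> mZ KZ mB mS.
have mBS : measurable ((B `*` setT) `&` S).
  by apply: measurableI => //; exact: measurableX.
have := @disintegration Z setT (cst 1%R) mZ measurableT (measurable_cst _)
  (fun _ => ler01) _ _ mBS.
rewrite setIT preimage_setI [X in P (X `&` _)](_ : _ = Y @^-1` B); last first.
  by apply/seteqP; split => [w []|w] /=.
move=> ->; last by move=> A0 B0 mA0 mB0; rewrite setIT KZ//;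
  under [RHS]eq_integral do rewrite mul1e.
rewrite [RHS]integral_mkcond; apply: eq_integral => w _.
rewrite mul1e xsectionI patchE; have [wB|wB] := boolP (w \in _).
  by rewrite in_xsectionX ?setTI//.
by rewrite notin_xsectionX ?set0I ?measure0.
Qed.

(** [cond_iid] only speaks of rectangles. They are replaced by [S] one copy at a time, by two nested
    disintegrations in which the other copy is carried by [D] and [h]. *)
Lemma cond_iid_xsection (Z1 Z2 : T -> F) (S : set (E * F)) :
  measurable_fun setT Z1 -> measurable_fun setT Z2 ->
  cond_iid P Z1 Z2 Y K -> measurable S ->
  P ((fun w => (Y w, Z1 w)) @^-1` S `&` (fun w => (Y w, Z2 w)) @^-1` S) =
  \int[P]_w (K (Y w) (xsection S (Y w)) * K (Y w) (xsection S (Y w))).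
Proof.
move=> mZ1 mZ2 KZ mS.
have finK y B : measurable B -> (fine (K y B))%:E = K y B.
  by move=> mB; rewrite fineK//; exact: finite_kernel_measure.
have finKS w : (fine (K (Y w) (xsection S (Y w))))%:E = K (Y w) (xsection S (Y w)).
  by rewrite finK//; exact: measurable_xsection.
have mYZ1 : measurable_fun setT (fun w => (Y w, Z1 w)).
  exact: measurable_fun_pair.
(* Outer disintegration along [Z2], with [D] the event that [(Y, Z1)] lies in [S]. Its hypothesis on
   rectangles is what remains to be shown. *)
rewrite setIC (@disintegration Z2 _
    (fun w => fine (K (Y w) (xsection S (Y w)))))//.
- by apply: eq_integral => w _; rewrite finKS.
- by rewrite -[_ @^-1` _]setTI; exact: mYZ1.
- apply: (measurableT_comp (f := fine)) => //.
  exact: measurable_kernel_xsection.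
move=> A B mA mB.
have mAS : measurable ((A `*` setT) `&` S).
  by apply: measurableI => //; exact: measurableX.
have mZ2B : measurable (Z2 @^-1` B) by rewrite -[_ @^-1` _]setTI; exact: mZ2.
(* Inner disintegration along [Z1], with [D] the event that [Z2] lies in [B]; here the hypothesis on
   rectangles is [cond_iid] itself. *)
have := @disintegration Z1 (Z2 @^-1` B) (fun w => fine (K (Y w) B))
  mZ1 mZ2B _ _ _ _ mAS.
rewrite preimage_setI [X in P (X `&` _ `&` _)](_ : _ = Y @^-1` A); last first.
  by apply/seteqP; split => [w []|w] /=.
rewrite setIAC => ->//.
- rewrite [RHS]integral_mkcond; apply: eq_integral => w _.
  rewrite xsectionI patchE; have [wA|wA] := boolP (w \in _).
    by rewrite in_xsectionX ?setTI// 1?muleC ?finKS ?finK//.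
  by rewrite notin_xsectionX ?set0I ?measure0 ?mule0.
- apply: (measurableT_comp (f := fine)) => //.
  apply: (measurableT_comp (f := fun y => K y B)) => //.
  exact: measurable_kernel.
- by move=> A0 B0 mA0 mB0; rewrite KZ//; apply: eq_integral => w _;
    rewrite finK// muleC.
Qed.

End disintegration.

(** * Variances and covariances of sums of indicators *)

Section bounded_random_variables.
Context {dT : measure_display} {T : measurableType dT} {R : realType}.
Variable P : probability T R.

Lemma bounded_Lfun2 (M : R) (f : T -> R) : measurable_fun setT f ->
  (forall w, `|f w| <= M) -> f \in Lfun P 2%:E.
Proof.
move=> mf fM; rewrite inE; apply/andP; split; rewrite inE//=.
rewrite /finite_norm unlock /= poweR_lty//.
apply: (@le_lt_trans _ _ (\int[P]_w (M `^ 2)%:E)%E); last first.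
  by rewrite integral_cst// lte_mul_pinfty ?lee_fin ?powR_ge0
    ?ltey_eq ?fin_num_measure.
apply: ge0_le_integral => //.
- apply/measurable_EFinP.
  apply: (@measurableT_comp _ _ _ _ _ _ (@powR R ^~ 2)) => //.
  exact: measurableT_comp.
- by move=> w _; rewrite lee_fin ge0_ler_powR// nnegrE (le_trans _ (fM w)).
Qed.

Lemma Lfun2_indic (A : set T) : measurable A -> \1_A \in Lfun P 2%:E.
Proof.
move=> mA; apply: (@bounded_Lfun2 1) => [|w]; first exact: measurable_indic.
by rewrite indicE; case: (_ \in _); rewrite ?normr1 ?normr0.
Qed.

Lemma Lfun2_sum_indic (I : finType) (E : I -> set T) :
  (forall i, measurable (E i)) ->
  (fun w => \sum_i \1_(E i) w) \in Lfun P 2%:E.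
Proof.
move=> mE; rewrite (_ : (fun _ => _) = \sum_i (\1_(E i) : T -> R)); last first.
  by apply/funext => w; rewrite fct_sumE.
by apply: rpred_sum => [|? i _]; [exact: lee1n|exact: Lfun2_indic].
Qed.

Lemma expectation_sum_indic (I : finType) (E : I -> set T) :
  (forall i, measurable (E i)) ->
  ('E_P[fun w => (\sum_i \1_(E i) w)%R] = (\sum_i fine (P (E i)))%R%:E)%E.
Proof.
move=> mE; rewrite unlock.
under eq_integral do rewrite -sumEFin.
rewrite ge0_integral_sum//; last first.
  by move=> i; exact/measurable_EFinP/measurable_indic.
rewrite -sumEFin; apply: eq_bigr => i _.
by rewrite integral_indic// setIT fineK// fin_num_measure.
Qed.

(** The product of the two sums is the sum, over pairs of indices, of the indicators of
    intersections. In this form independence cancels the covariance term by term. *)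
Lemma covariance_sum_indic (I J : finType) (E : I -> set T) (F : J -> set T) :
  (forall i, measurable (E i)) -> (forall j, measurable (F j)) ->
  covariance P (fun w => \sum_i \1_(E i) w) (fun w => \sum_j \1_(F j) w) =
  (\sum_i \sum_j
     (fine (P (E i `&` F j)) - fine (P (E i)) * fine (P (F j))))%:E.
Proof.
move=> mE mF.
have Pfin : P setT \is a fin_num by exact: fin_num_measure.
have E2 := Lfun2_sum_indic _ _ mE; have F2 := Lfun2_sum_indic _ _ mF.
rewrite covarianceE ?Lfun2_mul_Lfun1// ?(Lfun_subset12 Pfin)//.
rewrite !expectation_sum_indic//.
rewrite (_ : _ * _ = fun w => \sum_(k : I * J) \1_(E k.1 `&` F k.2) w).
  rewrite expectation_sum_indic; last by move=> k; exact: measurableI.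
  rewrite -EFinM -EFinB; congr EFin.
  rewrite -(pair_bigA _ (fun i j => fine (P (E i `&` F j))))/=.
  rewrite mulr_suml -sumrB; apply: eq_bigr => i _.
  by rewrite mulr_sumr sumrB.
apply/funext => w; rewrite fctE.
rewrite -(pair_bigA _ (fun i j => \1_(E i `&` F j) w))/=.
rewrite mulr_suml; apply: eq_bigr => i _; rewrite mulr_sumr.
by apply: eq_bigr => j _; rewrite indicI.
Qed.

(** In the double sum for the covariance of the sum with itself, pairwise independence kills the
    off-diagonal terms, and each of the [n] diagonal terms is [q - q * q]. *)
Lemma variance_sum_indep_indic (n : nat) (E : 'I_n -> set T) (q : R) :
  (forall i, measurable (E i)) -> (forall i, P (E i) = q%:E) ->
  (forall i j, i != j -> P (E i `&` E j) = (P (E i) * P (E j))%E) ->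
  ('V_P[fun w => (\sum_i \1_(E i) w)%R] = (n%:R * (q * (1 - q)))%R%:E)%E.
Proof.
move=> mE PE EI; rewrite /variance covariance_sum_indic//; congr EFin.
rewrite (eq_bigr (fun=> q * (1 - q))) => [|i _].
  by rewrite sumr_const card_ord mulr_natl.
rewrite (bigD1 i)//= big1 => [|j ji]; last first.
  by rewrite EI 1?eq_sym// !PE/= subrr.
by rewrite setIid !PE/= addr0 mulrBr mulr1.
Qed.

(** The covariance of the two sums vanishes, so the variance of the difference is the sum of the two
    variances; the bound discards the second one, which is nonnegative. *)
Lemma variance_sub_indep_indic (I J : finType) (E : I -> set T)
    (F : J -> set T) (a b : R) :
  (forall i, measurable (E i)) -> (forall j, measurable (F j)) ->
  (forall i j, P (E i `&` F j) = (P (E i) * P (F j))%E) ->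
  ((a ^+ 2)%:E * 'V_P[fun w => (\sum_i \1_(E i) w)%R] <=
   'V_P[((a \o* (fun w => \sum_i \1_(E i) w)) \-
         (b \o* (fun w => \sum_j \1_(F j) w)))%R])%E.
Proof.
move=> mE mF EF.
have Pfin : P setT \is a fin_num by exact: fin_num_measure.
have E2 := Lfun2_sum_indic _ _ mE; have F2 := Lfun2_sum_indic _ _ mF.
have L12 := Lfun_subset12 Pfin.
have bF2 : (b \o* (fun w => \sum_j \1_(F j) w)) \in Lfun P 2%:E.
  by apply: Lfun_scale => //; rewrite ler1n.
rewrite varianceB//; last by apply: Lfun_scale => //; rewrite ler1n.
rewrite (covarianceZl _ (L12 _ E2) (L12 _ bF2) (Lfun2_mul_Lfun1 E2 bF2)).
rewrite (covarianceZr _ (L12 _ E2) (L12 _ F2) (Lfun2_mul_Lfun1 E2 F2)).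
rewrite covariance_sum_indic//.
rewrite big1 => [|i _]; last first.
  by rewrite big1// => j _; rewrite EF fineM ?fin_num_measure// subrr.
by rewrite !mule0 sube0 varianceZ// leeDl// variance_ge0.
Qed.

(** Expectations are invariant under almost everywhere equality; this is used once for the means and
    once for the squared deviations. *)
Lemma ae_eq_variance (f g : T -> R) :
  measurable_fun setT f -> measurable_fun setT g ->
  ae_eq P setT f g -> ('V_P[f] = 'V_P[g])%E.
Proof.
move=> mf mg fg.
have E_eq (h k : T -> R) : measurable_fun setT h -> measurable_fun setT k ->
    ae_eq P setT h k -> ('E_P[h] = 'E_P[k])%E.
  move=> mh mk hk; rewrite unlock; apply: ae_eq_integral => //.
  - exact/measurable_EFinP.
  - exact/measurable_EFinP.
  - by apply: filterS hk => w /= hw /hw ->.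
rewrite /variance covariance.unlock (E_eq f g)//; apply: E_eq.
- by apply: measurable_funM; apply: measurable_funB.
- by apply: measurable_funM; apply: measurable_funB.
- by apply: filterS fg => w fgw wT; rewrite !fctE/= fgw.
Qed.

End bounded_random_variables.

(** * Almost everywhere uniqueness of conditional expectations *)

Section conditional_expectation.
Context {dT dE : measure_display} {T : measurableType dT}
  {E : measurableType dE} {R : realType}.
Variable P : probability T R.

Lemma preimage_sigma_algebra_measurable (Y : T -> E) (A : set T) :
  measurable_fun setT Y -> g_sigma_algebra_preimage Y A -> measurable A.
Proof. by move=> mY [B mB <-]; exact: mY. Qed.

Lemma cond_expectation_measurable (Y : T -> E) (Z C : T -> R) :
  measurable_fun setT Y -> is_cond_expectation P Z Y C ->
  measurable_fun setT C.
Proof.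
move=> mY [mC _ _] _ B mB; rewrite setTI.
exact: preimage_sigma_algebra_measurable mY (mC _ mB).
Qed.

(* Test the integrals on the event [C > g o Y] and on its complement, which
   belong to the sigma-algebra of [Y]. *)
Lemma cond_expectation_unique (Y : T -> E) (Z C : T -> R) (g : E -> R) :
  measurable_fun setT Y -> is_cond_expectation P Z Y C ->
  measurable_fun setT g ->
  P.-integrable setT (EFin \o (g \o Y)) ->
  (forall B, measurable B ->
     (\int[P]_(w in Y @^-1` B) (g (Y w))%:E =
      \int[P]_(w in Y @^-1` B) (Z w)%:E)%E) ->
  ae_eq P setT C (g \o Y).
Proof.
move=> mY CZ mg ig gZ; have mC := cond_expectation_measurable _ _ _ mY CZ.
case: CZ => Cpre iC CZ.
pose D w := C w - g (Y w).
have mD : measurable_fun setT D.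
  by apply: measurable_funB => //; exact: measurableT_comp.
have int0 A : g_sigma_algebra_preimage Y A -> (\int[P]_(w in A) (D w)%:E = 0)%E.
  move=> YA; have mA := preimage_sigma_algebra_measurable _ _ mY YA.
  have iCA : P.-integrable A (EFin \o C).
    by apply: integrableS iC.
  have igA : P.-integrable A (EFin \o (g \o Y)).
    by apply: integrableS ig.
  under eq_integral do rewrite /D EFinB.
  rewrite integralB_EFin// CZ//; case: YA => B mB; rewrite setTI => <-.
  rewrite gZ// subee//.
  have := gZ _ mB => <-.
  apply: integrable_fin_num => //; last first.
    apply: integrableS ig => //; rewrite -[_ @^-1` _]setTI; exact: mY.
  by rewrite -[_ @^-1` _]setTI; exact: mY.
(* Measurability in [T] is not enough for a test event: [D] is seen as a function on [T] equipped
   with the sigma-algebra of [Y]. *)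
have pre_gt : g_sigma_algebra_preimage Y [set w | 0 < D w].
  have mDY : measurable_fun [set: g_sigma_algebra_preimageType Y]
      (D : g_sigma_algebra_preimageType Y -> R).
    apply: measurable_funB; first by move=> _ B mB; rewrite setTI; exact: Cpre.
    apply: measurableT_comp => // _ B mB; rewrite setTI.
    by exists B => //; rewrite setTI.
  have /(_ measurableT) := mDY; move=> /(_ _ (@measurable_itv R `]0, +oo[)).
  by rewrite setTI /preimage/=; under eq_set do rewrite in_itv/= andbT.
have pre_le : g_sigma_algebra_preimage Y (~` [set w | 0 < D w]).
  case: pre_gt => B mB BD; exists (~` B); first exact: measurableC.
  by rewrite -BD !setTI preimage_setC.
have mgt := preimage_sigma_algebra_measurable _ _ mY pre_gt.
have Dae : ae_eq P setT (EFin \o D) (cst 0%E).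
  apply/ae_eq_integral_abs => //; first exact/measurable_EFinP.
  (* The absolute value of [D] is [D] on the event and [- D] on its complement, and [D] integrates
     to 0 over both. *)
  rewrite -(setUCr [set w | 0 < D w]) ge0_integral_setU//; first last.
  - by rewrite disj_set2E setICr.
  - by rewrite setUCr; do 2 apply: measurableT_comp => //.
  - exact: measurableC.
  rewrite [X in (X + _)%E](_ : _ = 0%E); last first.
    rewrite -(int0 _ pre_gt); apply: eq_integral => w; rewrite inE/= => Dw.
    by rewrite gtr0_norm.
  rewrite add0e; apply: oppe_inj; rewrite oppe0 -integral_ge0N//.
  rewrite -(int0 _ pre_le); apply: eq_integral => w; rewrite inE/= => /negP.
  by rewrite -leNgt => Dw; rewrite ler0_norm//= opprK.
apply: filterS Dae => w /= Dw /Dw [] /eqP.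
by rewrite subr_eq0 => /eqP.
Qed.

End conditional_expectation.

(** * Second moment of a conditional probability *)

Section conditional_probability.
Context {dT dE dF : measure_display} {T : measurableType dT}
  {E : measurableType dE} {F : measurableType dF} {R : realType}.
Variables (P : probability T R) (K : R.-pker E ~> F).

Lemma kernel_le1 (y : E) (B : set F) : measurable B -> (K y B <= 1)%E.
Proof. by move=> mB; rewrite -(prob_kernel (s := K) y) le_measure// inE. Qed.

(** The integrand is at most 1 and [P] is a probability. Finiteness allows this second moment to be
    handled as a real number. *)
Lemma integral_kernel_xsection_sqr_fin_num (Y : T -> E) (S : set (E * F)) :
  measurable_fun setT Y -> measurable S ->
  (\int[P]_w (K (Y w) (xsection S (Y w)) * K (Y w) (xsection S (Y w))))%E
    \is a fin_num.
Proof.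
move=> mY mS.
have mK := measurable_kernel_xsection Y K mY _ mS.
rewrite ge0_fin_numE; last by apply: integral_ge0 => w _; rewrite mule_ge0.
apply: (@le_lt_trans _ _ (\int[P]_w 1)%E); last first.
  by rewrite integral_cst// mul1e ltey_eq fin_num_measure.
apply: ge0_le_integral => //.
  exact: emeasurable_funM.
move=> w _; rewrite -[leRHS]mule1; apply: lee_pmul => //;
  exact/kernel_le1/measurable_xsection.
Qed.

(* E(1_S(Y, Z) | Y) = K Y S_Y, so both sides are the second moment of this
   conditional probability. *)
Lemma variance_cond_expectation_indic (Y : T -> E) (Z : T -> F)
    (S : set (E * F)) (C : T -> R) :
  measurable_fun setT Y -> measurable_fun setT Z ->
  is_cond_distribution P Z Y K -> measurable S ->
  is_cond_expectation P (\1_((fun w => (Y w, Z w)) @^-1` S)) Y C ->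
  ('V_P[C] + P ((fun w => (Y w, Z w)) @^-1` S) ^+ 2 =
   \int[P]_w (K (Y w) (xsection S (Y w)) * K (Y w) (xsection S (Y w))))%E.
Proof.
move=> mY mZ KZ mS Ccond.
pose g y := fine (K y (xsection S y)).
have gE y : (g y)%:E = K y (xsection S y).
  rewrite /g fineK//.
  by apply: finite_kernel_measure; exact: measurable_xsection.
have mg : measurable_fun setT g.
  apply: (measurableT_comp (f := fine)) => //.
  by apply: measurable_fun_xsection_finite_kernel; rewrite inE.
have mgY : measurable_fun setT (g \o Y) by exact: measurableT_comp.
have g2 : (g \o Y) \in Lfun P 2%:E.
  apply: (@bounded_Lfun2 _ _ _ _ 1) => // w /=.
  rewrite ger0_norm ?fine_ge0// -lee_fin gE.
  exact/kernel_le1/measurable_xsection.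
have ig : P.-integrable setT (EFin \o (g \o Y)).
  by apply/Lfun1_integrable/Lfun_subset12 => //; exact: fin_num_measure.
have mYZ : measurable_fun setT (fun w => (Y w, Z w)).
  exact: measurable_fun_pair.
have mYZS : measurable ((fun w => (Y w, Z w)) @^-1` S).
  by rewrite -[_ @^-1` _]setTI; exact: mYZ.
have gint B : measurable B -> (\int[P]_(w in Y @^-1` B) (g (Y w))%:E =
    \int[P]_(w in Y @^-1` B) (\1_((fun w => (Y w, Z w)) @^-1` S) w)%:E)%E.
  move=> mB; have mYB : measurable (Y @^-1` B).
    by rewrite -[_ @^-1` _]setTI; exact: mY.
  rewrite integral_indic// setIC [RHS](cond_distribution_xsection P Y K mY Z)//.
  by apply: eq_integral => w _; rewrite gE.
have mC := cond_expectation_measurable _ _ _ _ mY Ccond.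
rewrite (ae_eq_variance _ _ _ mC mgY); last first.
  exact: cond_expectation_unique Ccond _ _ _.
(* Law of total probability: this is [gint] tested on the whole space. *)
have -> : P ((fun w => (Y w, Z w)) @^-1` S) = ('E_P[g \o Y])%E.
  rewrite unlock -[X in P X]setIT -integral_indic//.
  by rewrite -(preimage_setT Y) -gint.
rewrite varianceE// subeK; last first.
  by rewrite fin_numX// expectation_fin_num// Lfun_subset12// fin_num_measure.
rewrite unlock; apply: eq_integral => w _.
by rewrite -gE -EFinM.
Qed.

End conditional_probability.

(** * The variance bound for the Pick-Freeze estimator *)

Theorem mainTheorem4 (R : realType) (disp : measure_display)
    (Omega : measurableType disp) (P : probability Omega R) (d : nat)
    (XX : 'I_d -> set R) (XX_meas : forall i, measurable (XX i))
    (X : {RV P >-> d.-tuple R}) (X_in : forall w, box XX (X w))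
    (fX : d.-tuple R -> R) (X_density : has_density P X fX)
    (phi : d.-tuple R -> R) (phi_meas : measurable_fun (box XX) phi) (t : R)
    (u : {set 'I_d}) (u_neq0 : u != finset.set0) (u_neqT : u != [set: 'I_d]%SET)
    (N Nu : nat) (N_ge1 : (1 <= N)%N) (Nu_ge1 : (1 <= Nu)%N)
    (K : R.-pker (#|u|.-tuple R) ~> (#|~: u|.-tuple R))
    (K_cond : is_cond_distribution P (subvec (~: u) \o X) (subvec u \o X) K)
    (Xu : 'I_Nu -> {RV P >-> #|u|.-tuple R})
    (Xc1 Xc2 : 'I_Nu -> {RV P >-> #|~: u|.-tuple R})
    (Xc1_in : forall n w, box XX (mergevec (Xu n w) (Xc1 n w)))
    (Xc2_in : forall n w, box XX (mergevec (Xu n w) (Xc2 n w)))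
    (Xu_law : forall n, same_law P (Xu n) (subvec u \o X))
    (Xc_cond : forall n, cond_iid P (Xc1 n) (Xc2 n) (Xu n) K)
    (PF_indep : mutually_independent P (fun n w => (Xu n w, Xc1 n w, Xc2 n w)))
    (Xs : 'I_N -> {RV P >-> d.-tuple R})
    (Xs_in : forall n w, box XX (Xs n w))
    (Xs_density : forall n, has_density P (Xs n) fX)
    (Xs_indep : mutually_independent P Xs)
    (PF_Xs_indep :
      independent_families P (fun n w => (Xu n w, Xc1 n w, Xc2 n w)) Xs)
    (C : Omega -> R)
    (C_cond : is_cond_expectation P (psi phi t \o X) (subvec u \o X) C) :
  let T_VE := ('V_P[C])%E in
  let p_t := P [set w | t < phi (X w)] in
  ('V_P[TVE_PF phi t Xu Xc1 Xc2 Xs] >=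
    (Nu%:R^-1)%:E * ((T_VE + p_t ^+ 2) * (1 - (T_VE + p_t ^+ 2))))%E.
Proof.
cbv zeta; set T_VE := ('V_P[C])%E; set p_t := P [set w | t < phi (X w)].
(* [phi] is measurable on the box only, so the exceedance set is intersected with it; on samples,
   which stay in the box, the indicator is unchanged. *)
pose A := box XX `&` phi @^-1` `]t, +oo[.
have mA : measurable A.
  exact: (phi_meas (measurable_box _ _ _ XX_meas) _ (measurable_itv _)).
have psiE x : box XX x -> psi phi t x = \1_A x.
  move=> XXx; rewrite /psi !indicE; congr (_%:R); congr nat_of_bool.
  apply/idP/idP; rewrite !inE/=.
    by move=> tx; split => //=; rewrite in_itv/= andbT.
  by case=> _ /=; rewrite in_itv/= andbT.
pose S := (fun p : #|u|.-tuple R * #|~: u|.-tuple R => mergevec p.1 p.2) @^-1` A.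
have mS : measurable S.
  by rewrite /S -[_ @^-1` _]setTI; exact: measurable_mergevec.
pose Y := subvec u \o X; pose Z := subvec (~: u) \o X.
have mY : measurable_fun setT Y.
  by apply: measurableT_comp => //; exact: measurable_subvec.
have mZ : measurable_fun setT Z.
  by apply: measurableT_comp => //; exact: measurable_subvec.
have psiXE : psi phi t \o X = \1_((fun w => (Y w, Z w)) @^-1` S).
  apply/funext => w /=; rewrite psiE// !indicE; congr (_%:R); congr nat_of_bool.
  by apply/idP/idP; rewrite !inE /S/= mergevecK.
have p_tE : p_t = P ((fun w => (Y w, Z w)) @^-1` S).
  congr (P _); apply/seteqP; split => w; rewrite /S/= mergevecK.
    by move=> tw; split => //=; rewrite in_itv/= andbT.
  by case=> _ /=; rewrite in_itv/= andbT.
have /fineK := integral_kernel_xsection_sqr_fin_num P K Y S mY mS.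
set q := fine _ => qE.
have TVEE : (T_VE + p_t ^+ 2 = q%:E)%E.
  rewrite p_tE qE; apply: (variance_cond_expectation_indic P K Y Z S C) => //.
  by rewrite -psiXE.
rewrite TVEE.
have mXu n : measurable_fun setT (Xu n) by [].
have mXc1 n : measurable_fun setT (Xc1 n) by [].
have mXc2 n : measurable_fun setT (Xc2 n) by [].
pose W n w := (Xu n w, Xc1 n w, Xc2 n w).
pose SS : set (#|u|.-tuple R * #|~: u|.-tuple R * #|~: u|.-tuple R) :=
  (fst @^-1` S) `&` ((fun p => (p.1.1, p.2)) @^-1` S).
have mSS : measurable SS.
  apply: measurableI; rewrite -[X in measurable X]setTI; first exact: measurable_fst.
  have /(_ measurableT _ mS) : measurable_fun setT
    (fun p : #|u|.-tuple R * #|~: u|.-tuple R * #|~: u|.-tuple R =>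
       (p.1.1, p.2)); last by apply.
  by apply: measurable_fun_pair => //; apply: measurableT_comp.
pose E n := W n @^-1` SS.
have mE n : measurable (E n).
  rewrite -[E n]setTI; have : measurable_fun setT (W n); last by apply.
  by apply: measurable_fun_pair => //; exact: measurable_fun_pair.
have PE n : P (E n) = q%:E.
  have -> : P (E n) = P ((fun w => (Xu n w, Xc1 n w)) @^-1` S `&`
                         (fun w => (Xu n w, Xc2 n w)) @^-1` S) by [].
  rewrite (cond_iid_xsection P (Xu n) K (mXu n) _ _ _ (mXc1 n) (mXc2 n))// qE.
  pose h y := (K y (xsection S y) * K y (xsection S y))%E.
  have mh : measurable_fun setT h.
    by apply: emeasurable_funM;
      apply: measurable_fun_xsection_finite_kernel; rewrite inE.
  have h0 y : (0 <= h y)%E by exact: mule_ge0.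
  have := ge0_integral_pushforward (mXu n) P measurableT mh (fun y _ => h0 y).
  have := ge0_integral_pushforward mY P measurableT mh (fun y _ => h0 y).
  rewrite !preimage_setT => <- <-.
  by apply: eq_measure_integral => B mB _; exact: Xu_law.
have EI i j : i != j -> P (E i `&` E j) = (P (E i) * P (E j))%E.
  move=> ij.
  (* Pairwise independence comes from the product rule over the whole family, taking the full space
     at every index other than [i] and [j]. *)
  pose B k := if (k == i) || (k == j) then SS else setT.
  have mB k : measurable (B k) by rewrite /B; case: ifP.
  have := PF_indep B mB.
  rewrite (bigD1 i)//= (bigD1 j) 1?eq_sym//= big1 ?mule1 => [|k /andP[ki kj]].
    rewrite {2 3}/B !eqxx orbT /= => <-; congr (P _).
    apply/seteqP; split => w /=.
      by move=> [Ei Ej] k _; rewrite /B; case: ifPn => // /orP[] /eqP ->.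
    by move=> H; split; [have := H i I|have := H j I]; rewrite /B eqxx ?orbT.
  by rewrite /B (negbTE ki) (negbTE kj) preimage_setT probability_setT.
(* Expanding the square, [p_hat] squared is [N^-2] times the sum of the indicators of these events
   over all ordered pairs, diagonal included. *)
pose F (k : 'I_N * 'I_N) := Xs k.1 @^-1` A `&` Xs k.2 @^-1` A.
have sF (i : 'I_N) : sigma_of_family Xs (Xs i @^-1` A).
  by apply: sub_sigma_algebra; exists i => //; exists A => //; rewrite setTI.
have mXsA i : measurable (Xs i @^-1` A).
  by rewrite -[_ @^-1` _]setTI; have : measurable_fun setT (Xs i); [|apply].
have mF k : measurable (F k) by exact: measurableI.
have EF n k : P (E n `&` F k) = (P (E n) * P (F k))%E.
  apply: PF_Xs_indep.
    by apply: sub_sigma_algebra; exists n => //; exists SS => //; rewrite setTI.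
  exact: (@measurableI _ (g_sigma_algebraType
    (\bigcup_i preimage_set_system setT (Xs i) measurable)) _ _ (sF k.1) (sF k.2)).
have estE : TVE_PF phi t Xu Xc1 Xc2 Xs =
    (Nu%:R^-1 \o* (fun w => \sum_n \1_(E n) w)) \-
    ((N%:R^-1 ^+ 2) \o* (fun w => \sum_k \1_(F k) w)).
  apply/funext => w; rewrite /TVE_PF /p_hat /= mulrC; congr (_ * _ - _).
    apply: eq_bigr => n _; rewrite !psiE//.
    rewrite !indicE -natrM mulnb; congr (_%:R).
    by congr nat_of_bool; apply/andP/idP; rewrite !inE.
  rewrite exprMn mulrC; congr (_ * _).
  rewrite -(pair_bigA _ (fun i j => \1_(Xs i @^-1` A `&` Xs j @^-1` A) w))/=.
  rewrite expr2 mulr_suml; apply: eq_bigr => i _; rewrite mulr_sumr.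
  by apply: eq_bigr => j _; rewrite !psiE// indicI.
rewrite estE; apply: le_trans (variance_sub_indep_indic _ _ _ _ _ _ _ mE mF EF).
rewrite (variance_sum_indep_indic _ _ _ q)// -EFinB -!EFinM lee_fin.
(* The factor [Nu^-2] meets the [Nu] equal diagonal variances; one factor cancels because [Nu] is
   positive. *)
by rewrite expr2 -[leRHS]mulrA mulKf// pnatr_eq0 -lt0n.
Qed.
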